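(* Let $A\in\mathrm{GL}_n(\mathbb{Q})$, let $f_A(t)$ be the characteristic polynomial of $A$, let $K$ be the splitting field of $f_A(t)$ over $\mathbb{Q}$, and let $\alpha_1,\dots,\alpha_n$ be the roots of $f_A(t)$ in $K$. Then for all sufficiently large rational primes $p$ the following holds. (1) If $A$ is diagonalizable over $K$ then $$\mathrm{ord}_p(A)=\mathrm{LCM}\left(\{\mathrm{ord}_p(\alpha_i)\}_{i=1,2,\dots,n}\right).$$ (2) If $A$ is not diagonalizable over $K$ then $$\mathrm{ord}_p(A)=p\times\mathrm{LCM}\left(\{\mathrm{ord}_p(\alpha_i)\}_{i=1,2,\dots,n}\right).$$
   Context: For all but finitely many primes $p$ the reduction $A\bmod p$ is defined and lies in $\mathrm{GL}_n(\mathbb{F}_p)$; $\mathrm{ord}_p(A)$ denotes the order of $A\bmod p$ in $\mathrm{GL}_n(\mathbb{F}_p)$. $\mathcal{O}_K$ is the ring of integers of $K$. For $\alpha=\beta_0/\beta_1\in K$ with $\beta_0,\beta_1\in\mathcal{O}_K$, coprime to $p$ in $K$, $\mathrm{ord}_p(\alpha)$ denotes the order of (the image of) $\alpha$ in $(\mathcal{O}_K/p\mathcal{O}_K)^\times$. *)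

(* Defs.v *)
From HB Require Import structures.
From mathcomp Require Import all_boot all_order all_fingroup all_algebra all_field.
From mathcomp Require Import boolp classical_sets.

Set Implicit Arguments.
Unset Strict Implicit.
Unset Printing Implicit Defensive.

Import GRing.Theory Num.Theory.
Local Open Scope ring_scope.
Local Open Scope quotient_scope.

(* Multiplicative order of an element of a ring, with value 0 when no positive
   power of the element is 1. *)
Definition mul_order (R : nzRingType) (u : R) : nat :=
  if pselect (exists k : nat, (0 < k)%N && (u ^+ k == 1)) is left h
  then ex_minn h else 0%N.

(* [ratr] sends a / b in lowest terms to a%:~R / b%:~R; over 'F_p this is the
   reduction modulo p exactly when p does not divide b. *)
Definition reducible_mx (n p : nat) (A : 'M[rat]_n) : Prop :=
  forall i j, ~~ (p%:Z %| denq (A i j))%Z.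

Definition red_mx (n p : nat) (A : 'M[rat]_n) : 'M['F_p]_n :=
  map_mx (ratr : rat -> 'F_p) A.

(* The default value 1 is only used when [red_mx p A] is singular. *)
Definition ord_mx (n p : nat) (A : 'M[rat]_n.+1) : nat :=
  #[insubd (1%g : {'GL_n.+1['F_p]}) (red_mx p A)]%g.

Section IntegerRing.
Variable K : fieldExtType rat.

Definition ringOfIntegers_pred : pred K :=
  fun x => `[< integralOver (intr : int -> K) x >].

Fact ringOfIntegers_subring : subring_closed ringOfIntegers_pred.
Proof.
split=> [|x y /asboolP Ox /asboolP Oy|x y /asboolP Ox /asboolP Oy]; apply/asboolP.
- exact: integral1.
- exact: integral_sub.
- exact: integral_mul.
Qed.

HB.instance Definition _ :=
  GRing.isSubringClosed.Build K ringOfIntegers_pred ringOfIntegers_subring.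

Record ringOfIntegers :=
  RingOfIntegers { OK_val :> K; _ : OK_val \in ringOfIntegers_pred }.

HB.instance Definition _ := [isSub for OK_val].
HB.instance Definition _ := [Choice of ringOfIntegers by <:].
HB.instance Definition _ :=
  [SubChoice_isSubComNzRing of ringOfIntegers by <:].

End IntegerRing.

Section ReductionModp.
Variables (K : fieldExtType rat) (p : nat) (p_pr : prime p).
Local Notation OK := (ringOfIntegers K).

Lemma inv_nat_not_integral (x : K) :
  integralOver (intr : int -> K) x -> p%:R * x <> 1.
Proof.
move=> [q mon_q qx0] px1.
have injK : injective (intr : int -> K).
  move=> a b /=; rewrite -!(rmorph_int (in_alg K)) => /fmorph_inj.
  exact: intr_inj.
pose d := (size q).-1.
have sq : size q = d.+1 by rewrite prednK // lt0n size_poly_eq0 monic_neq0.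
have := rootP qx0; rewrite horner_coef size_map_poly_id0; last first.
  by rewrite (monicP mon_q) rmorph1 oner_eq0.
rewrite sq big_ord_recr /= !coef_map /=.
have -> : q`_d = 1 by rewrite -(monicP mon_q).
rewrite mul1r => /(congr1 (fun y => p%:R ^+ d * y)).
rewrite mulr0 mulrDr -exprMn px1 expr1n mulr_sumr.
have -> : \sum_(i < d) p%:R ^+ d * ((map_poly intr q)`_i * x ^+ i) =
          (p%:Z * \sum_(i < d) p%:Z ^+ (d - i.+1) * q`_i)%:~R :> K.
  rewrite rmorphM rmorph_sum mulr_sumr; apply: eq_bigr => i _.
  have {1}-> : d = ((d - i.+1).+1 + i)%N by rewrite addSnnS subnK.
  rewrite coef_map /= !rmorphM rmorphXn /= exprD exprS.
  by rewrite mulrACA -exprMn px1 expr1n mulr1 -mulrA.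
rewrite -[X in _ + X](rmorph1 (intr : int -> K)) -rmorphD.
rewrite -[RHS](rmorph0 (intr : int -> K)) => /injK /eqP.
rewrite addrC addr_eq0 => /eqP E.
have : (p%:Z %| 1%R)%Z by rewrite E rpredN dvdz_mulr // dvdzz.
by rewrite dvdz1 /= => /eqP p1; move: (p_pr); rewrite p1.
Qed.

(* The primality proof is an argument because the library only forms quotients
   by proper ideals. *)
Definition pOK (_ : prime p) : OK -> bool :=
  fun x => `[< exists y : OK, x = p%:R * y >].

Fact pOK_ideal : idealr_closed (pOK p_pr).
Proof.
split=> [||a x y /asboolP[u ->] /asboolP[v ->]].
- by apply/asboolP; exists 0; rewrite mulr0.
- apply/asboolP=> -[y] /(congr1 val).
  rewrite rmorph1 rmorphM rmorph_nat => /esym.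
  by apply: inv_nat_not_integral; apply/asboolP/(valP y).
- by apply/asboolP; exists (a * u + v); rewrite mulrDr mulrCA.
Qed.
HB.instance Definition _ := isIdealr.Build OK (pOK p_pr) pOK_ideal.

Definition OKmod : Type := {ideal_quot (pOK p_pr : idealr OK)}.
HB.instance Definition _ := GRing.ComNzRing.on OKmod.
HB.instance Definition _ := ZmodQuotient.on OKmod.

Definition pi_OK : OK -> OKmod := \pi_({ideal_quot (pOK p_pr : idealr OK)}).
HB.instance Definition _ := GRing.RMorphism.on pi_OK.

Definition OKmod_unit : pred OKmod := fun u => `[< exists v, v * u = 1 >].

Definition OKmod_inv (u : OKmod) : OKmod :=
  if pselect (exists v, v * u = 1) is left h then sval (cid h) else u.

Fact OKmod_mulVx : {in OKmod_unit, left_inverse 1 OKmod_inv *%R}.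
Proof.
by move=> u /asboolP Uu; rewrite /OKmod_inv; case: pselect => // h; case: cid.
Qed.

Fact OKmod_unitPl (u v : OKmod) : v * u = 1 -> OKmod_unit u.
Proof. by move=> vu1; apply/asboolP; exists v. Qed.

Fact OKmod_invr_out : {in [predC OKmod_unit], OKmod_inv =1 id}.
Proof.
by move=> u /asboolP nUu; rewrite /OKmod_inv; case: pselect.
Qed.

HB.instance Definition _ := GRing.ComNzRing_hasMulInverse.Build OKmod
  OKmod_mulVx OKmod_unitPl OKmod_invr_out.

Definition coprime_OK (b : OK) : Prop := exists u v : OK, u * b + p%:R * v = 1.

Definition coprime_frac (a : K) (b : OK * OK) : Prop :=
  [/\ coprime_OK b.1, coprime_OK b.2 & a = val b.1 / val b.2].

Definition coprime_elt (a : K) : Prop := exists b, coprime_frac a b.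

(* The image of a = b.1 / b.2; by [red_eltE] it does not depend on the chosen
   fraction.  The default fraction is only used when a is not coprime to p. *)
Definition red_elt (a : K) : OKmod :=
  let b := xget (1, 1) [set b | coprime_frac a b] in pi_OK b.1 / pi_OK b.2.

Lemma pi_OK_unit (b : OK) : coprime_OK b -> pi_OK b \is a GRing.unit.
Proof.
move=> [u [v uv1]]; apply/asboolP; exists (pi_OK u).
have pv0 : pi_OK (p%:R * v) = 0.
  apply/eqP; rewrite -(rmorph0 pi_OK) -Quotient.idealrBE subr0.
  by apply/asboolP; exists v.
by have := congr1 pi_OK uv1; rewrite rmorphD /= pv0 addr0 rmorphM rmorph1.
Qed.

Lemma coprime_OK_neq0 (b : OK) : coprime_OK b -> val b != 0.
Proof.
move=> /pi_OK_unit; apply: contraTneq => b0.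
by have -> : b = 0 by [apply: val_inj]; rewrite rmorph0 unitr0.
Qed.

Lemma red_eltE (a : K) (b : OK * OK) :
  coprime_frac a b -> red_elt a = pi_OK b.1 / pi_OK b.2.
Proof.
move=> fab; rewrite /red_elt; case: xgetP => [c _ fac|/(_ b)//].
case: fab fac => [_ cb2 ->] [_ cc2 /eqP].
rewrite eqr_div ?coprime_OK_neq0 // => /eqP e.
have {}e : b.1 * c.2 = c.1 * b.2 by apply: val_inj; rewrite !rmorphM.
apply/eqP; rewrite eq_sym -(inj_eq (mulIr (pi_OK_unit cb2))) divrK ?pi_OK_unit //.
rewrite mulrAC -(inj_eq (mulIr (pi_OK_unit cc2))) divrK ?pi_OK_unit //.
by rewrite -!rmorphM e.
Qed.

Definition ord_elt (a : K) : nat := mul_order (red_elt a).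

End ReductionModp.

(* Main.v *)
Require Import Defs.
From HB Require Import structures.
From mathcomp Require Import all_boot all_order all_fingroup all_algebra all_field.
From mathcomp Require Import boolp ring zify cyclic.

(* Let r be the squarefree part of the characteristic polynomial f of A, so that
   over K it is the product of the X - a over the distinct roots a of f.  For p
   large everything in sight can be reduced modulo p: r stays separable over F_p,
   r | f | r^(n+1) still holds, and over O_K / p the polynomial r splits into
   linear factors whose roots differ by units.  The last fact gives, for every
   k, that all the roots of f satisfy a^k = 1 modulo p iff r | X^k - 1 over F_p;
   so no reducedness of O_K / p is needed.  The rest takes place over F_p.  If
   A^k = 1 then f divides a power of X^k - 1, hence so does r, and the order of
   A is a multiple of the lcm L of the orders of the roots.  If r(A) = 0 then
   A^L = 1.  Otherwise f | r^p | X^(pL) - 1, so the order is L or pL; moreover p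
   does not divide L since r is separable and X^(pk) - 1 = (X^k - 1)^p, so
   A^L = 1 would make the minimal polynomial of A separable, hence a divisor of
   r, which is absurd.  Finally, A is diagonalizable over K iff r(A) = 0. *)

Set Implicit Arguments.
Unset Strict Implicit.
Unset Printing Implicit Defensive.

Import GRing.Theory Num.Theory.
Local Open Scope ring_scope.

(** * Separability and matrix polynomials over a field *)

(** Write p = e g with g = gcd(p, q). Separability makes e coprime to g, hence to q, so e can divide
    a power of q only if it is constant. *)
Lemma separable_dvdp_exp (F : fieldType) (p q : {poly F}) (m : nat) :
  separable_poly p -> p %| q ^+ m -> p %| q.
Proof.
move=> sep_p p_qm.
have p0 := separable_poly_neq0 sep_p.
set g := gcdp p q; have [e De] : exists e, p = e * g.
  by exists (p %/ g); rewrite divpK ?dvdp_gcdl.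
have cop_eg : coprimep e g by apply: (separable_coprime sep_p); rewrite -De.
have cop_eq : coprimep e q.
  rewrite /coprimep -dvdp1.
  apply: (@dvdp_trans _ (gcdp e g)); last by rewrite dvdp1.
  by rewrite !dvdp_gcd dvdp_gcdl dvdp_gcdr andbT /= [in X in _ %| X]De
             (dvdp_trans (dvdp_gcdl _ _)) // dvdp_mulr.
have e1 : e %| 1.
  rewrite -(@Gauss_dvdpl _ 1 (q ^+ m) e) ?mul1r ?coprimep_expr //.
  by apply: dvdp_trans p_qm; rewrite De dvdp_mulr.
rewrite De; apply: dvdp_trans (dvdp_gcdr p q).
by rewrite -[X in _ %| X]mul1r dvdp_mul.
Qed.

(** By the factor theorem over the matrix ring, X - A divides q as a polynomial with scalar matrix
    coefficients; determinants then give the divisibility. *)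
Lemma char_poly_dvd_exp (F : fieldType) (n : nat) (A : 'M[F]_n.+1) (q : {poly F}) :
  horner_mx A q = 0 -> char_poly A %| q ^+ n.+1.
Proof.
move=> qA0; have [phi [[psi phiK psiK] phiZ phiC _]] := mx_poly_ring_isom F n.
have /factor_theorem[s Ds] : root (map_poly scalar_mx q) A by apply/rootP.
suff -> : q ^+ n.+1 = \det (psi s) * char_poly A by rewrite dvdp_mull.
rewrite -det_scalar -det_mulmx; congr (\det _); apply: (can_inj phiK).
by rewrite phiZ Ds rmorphM psiK /= rmorphB phiZ phiC map_polyX.
Qed.

Lemma horner_mx_Xn_sub1 (F : fieldType) (n : nat) (A : 'M[F]_n.+1) (k : nat) :
  (horner_mx A ('X^k - 1) == 0) = (A ^+ k == 1).
Proof. by rewrite rmorphB rmorphXn /= horner_mx_X rmorph1 subr_eq0. Qed.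

Lemma Xn_sub1_pchar (F : fieldType) (p : nat) (k : nat) :
  p \in [pchar F] -> 'X^(k * p) - 1 = ('X^k - 1 : {poly F}) ^+ p.
Proof.
move=> pF; have pX : p \in [pchar {poly F}] by rewrite (rmorph_pchar polyC).
by rewrite -!(pFrobenius_autE pX) pFrobenius_autB_comm ?pFrobenius_aut1
           ?pFrobenius_autE -?exprM //; apply: mulrC.
Qed.

Lemma separable_Xn_sub1 (F : fieldType) (k : nat) :
  k%:R != 0 :> F -> separable_poly ('X^k - 1 : {poly F}).
Proof.
move=> k0; have k_gt0 : (0 < k)%N by case: k k0; rewrite ?eqxx.
(* The Bezout relation is -(X^k - 1) + (X / k) (k X^(k-1)) = 1. *)
rewrite unlock; apply/Bezout_eq1_coprimepP; exists (- 1, k%:R^-1 *: 'X) => /=.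
rewrite derivB derivXn -scaler_nat derivC subr0 -scalerAl -scalerAr.
by rewrite scalerA mulVf // scale1r -exprS prednK // mulN1r opprB subrK.
Qed.

(** * The order of a matrix in characteristic p *)

Section OrderModp.
Variables (F : fieldType) (p n : nat) (B : 'M[F]_n.+1) (r : {poly F}) (d L : nat).
Hypotheses (pF : p \in [pchar F]) (n_lt_p : (n < p)%N) (d_gt0 : (0 < d)%N).
Hypotheses (sep_r : separable_poly r) (r_char : r %| char_poly B)
  (char_r : char_poly B %| r ^+ n.+1).
Hypotheses (dP : forall k, (d %| k)%N = (B ^+ k == 1))
  (LP : forall k, (L %| k)%N = (r %| 'X^k - 1)).

(** In the application d is the order of B and L the lcm of the orders of the roots modulo p; [dP]
    and [LP] describe each by the exponents that it divides. *)
Lemma order_semisimple : horner_mx B r = 0 -> d = L.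
Proof.
move=> rB0; apply/eqP; rewrite eqn_dvd; apply/andP; split.
  have : r %| 'X^L - 1 by rewrite -LP.
  by rewrite dP -horner_mx_Xn_sub1 => /dvdpP[q ->]; rewrite rmorphM /= rB0 mulr0.
rewrite LP; apply: (@separable_dvdp_exp _ _ _ n.+1) => //.
apply: dvdp_trans r_char _; apply: char_poly_dvd_exp; apply/eqP.
by rewrite horner_mx_Xn_sub1 -dP.
Qed.

Lemma order_not_semisimple : horner_mx B r != 0 -> d = (p * L)%N.
Proof.
move=> rB0; have p_pr := pcharf_prime pF.
have Ld : (L %| d)%N.
  rewrite LP; apply: (@separable_dvdp_exp _ _ _ n.+1) => //.
  apply: dvdp_trans r_char _; apply: char_poly_dvd_exp; apply/eqP.
  by rewrite horner_mx_Xn_sub1 -dP.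
have L_gt0 : (0 < L)%N := dvdn_gt0 d_gt0 Ld.
have dpL : (d %| L * p)%N.
  rewrite dP -horner_mx_Xn_sub1 Xn_sub1_pchar //.
  have : char_poly B %| ('X^L - 1) ^+ p.
    apply: dvdp_trans char_r _; apply: dvdp_trans (dvdp_exp2l _ n_lt_p) _.
    by rewrite dvdp_exp2r // -LP.
  by move=> /dvdpP[q ->]; rewrite rmorphM /= Cayley_Hamilton mulr0.
have pL : ~~ (p %| L)%N.
  apply/negP=> /dvdnP[k Dk]; have : r %| 'X^k - 1.
    apply: (@separable_dvdp_exp _ _ _ p) => //.
    by rewrite -Xn_sub1_pchar // -Dk -LP.
  have k_gt0 : (0 < k)%N by move: L_gt0; rewrite Dk; case: (k).
  rewrite -LP Dk => /(dvdn_leq k_gt0); rewrite leqNgt ltn_Pmulr //.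
  exact: prime_gt1.
(* With d = e L, the factor e divides the prime p; e = p is the claim, and e = 1 would give B^L =
   1. *)
have [e De] := dvdnP Ld; move: dpL; rewrite De mulnC dvdn_pmul2l //.
case/primeP: p_pr => _ p_pr /p_pr/orP[]/eqP De1; last by rewrite De1 mulnC.
case/negP: rB0; rewrite -dvd_mxminpoly.
apply: (@separable_dvdp_exp _ _ _ n.+1); last first.
  exact: dvdp_trans (mxminpoly_dvd_char B) char_r.
apply: (@dvdp_separable _ ('X^L - 1)).
  by rewrite dvd_mxminpoly horner_mx_Xn_sub1 -dP De De1 mul1n.
by apply: separable_Xn_sub1; rewrite -(dvdn_pcharf pF).
Qed.
End OrderModp.

(** * Divisibility and units under ring morphisms *)

(** The remainder of g by r vanishes on s but has degree below the length of s. Even with zero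
    divisors in R this forces it to be 0, because the elements of s differ pairwise by units. *)
Lemma dvdp_map_roots (F : fieldType) (R : comUnitRingType)
    (iota : {rmorphism F -> R}) (r g : {poly F}) (s : seq R) :
  map_poly iota r = \prod_(z <- s) ('X - z%:P) -> uniq_roots s ->
  (r %| g) = all (root (map_poly iota g)) s.
Proof.
move=> Dr uniq_s; apply/idP/idP=> [/dvdpP[q ->]|all_s].
  apply/allP=> z s_z; rewrite rmorphM /= Dr rootE hornerM.
  by rewrite (big_rem z s_z) /= hornerM hornerXsubC subrr mul0r mulr0.
rewrite /dvdp; apply: contraT => rem_neq0.
have r_neq0 : r != 0.
  by apply/eqP=> r0; have := monic_prod_XsubC s xpredT id;
     rewrite -Dr r0 rmorph0 monicE lead_coef0 eq_sym oner_eq0.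
have all_rem : all (root (map_poly iota (g %% r))) s.
  apply/allP=> z s_z; move/allP/(_ z s_z): all_s.
  rewrite {1}(divp_eq g r) rmorphD rmorphM /= Dr !rootE hornerD hornerM.
  by rewrite (big_rem z s_z) /= hornerM hornerXsubC subrr mul0r mulr0 add0r.
have := max_ring_poly_roots _ all_rem uniq_s.
rewrite map_poly_eq0 => /(_ rem_neq0); rewrite size_map_poly -ltnS.
rewrite -(size_prod_XsubC s id) -Dr size_map_poly.
by rewrite ltnNge -ltnS ltnNge /= => /negP[]; rewrite -ltnNge ltnS ltn_modp.
Qed.

(** The relation x y = 1 holds in k, hence in T, and survives [red]. Nonvanishing over Q or K thus
    becomes invertibility modulo p once the inverse is integral at p. *)
Lemma rmorph_unit_of_inv (T : comNzRingType) (k : fieldType) (R : comUnitRingType)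
    (inc : {rmorphism T -> k}) (red : {rmorphism T -> R}) (x y : T) :
  injective inc -> inc x != 0 -> inc y = (inc x)^-1 -> red x \is a GRing.unit.
Proof.
move=> inc_inj x0 Dy; apply/unitrPr; exists (red y).
rewrite -rmorphM -[RHS](rmorph1 red); congr (red _); apply: inc_inj.
by rewrite rmorphM rmorph1 Dy mulfV.
Qed.

(** * Localizations and their reduction maps, for both Q and K *)

Section Localization.
Variables (O : comNzRingType) (k : fieldType) (R : comUnitRingType).
Variables (f : {rmorphism O -> k}) (g : {rmorphism O -> R}).

(* The localization of O at the elements that g inverts, realised inside k. *)
Definition loc_pred : pred k := fun x =>
  `[< exists b : O * O,
        [/\ g b.2 \is a GRing.unit, f b.2 != 0 & x = f b.1 / f b.2] >].

Fact loc_subring : subring_closed loc_pred.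
Proof.
split=> [|x y /asboolP[[a b] /= [Ub b0 ->]] /asboolP[[c d] /= [Ud d0 ->]]
         |x y /asboolP[[a b] /= [Ub b0 ->]] /asboolP[[c d] /= [Ud d0 ->]]];
  apply/asboolP.
- by exists (1, 1) => /=; rewrite !rmorph1 unitr1 oner_neq0 divr1.
- exists (a * d - c * b, b * d) => /=.
  rewrite !rmorphM unitrM Ub Ud mulf_neq0 //; split=> //.
  by rewrite rmorphB !rmorphM; field; rewrite b0 d0.
- exists (a * c, b * d) => /=.
  rewrite !rmorphM unitrM Ub Ud mulf_neq0 //; split=> //.
  by rewrite mulf_div.
Qed.
HB.instance Definition _ := GRing.isSubringClosed.Build k loc_pred loc_subring.

Record loc := Loc { loc_val :> k; _ : loc_val \in loc_pred }.
HB.instance Definition _ := [isSub for loc_val].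
HB.instance Definition _ := [Choice of loc by <:].
HB.instance Definition _ := [SubChoice_isSubComNzRing of loc by <:].

Definition loc_red_def (x : loc) : R :=
  let b := sval (cid (asboolP _ (valP x))) in g b.1 / g b.2.

Hypothesis f_inj : injective f.
(* The injectivity of f, on which the morphism property depends, is an argument
   so that the morphism structure can be attached to this constant. *)
Definition loc_red of injective f := loc_red_def.
Local Notation red := (loc_red f_inj).

(** Independence of the chosen fraction: cross-multiplication holds in k, descends to O by
    injectivity of f, and is mapped to R by g. *)
Lemma loc_redE (x : loc) (u v : O) : g v \is a GRing.unit ->
  val x * f v = f u -> red x = g u / g v.
Proof.
move=> Uv Dx; rewrite /loc_red /loc_red_def; case: cid => -[a b] /= [Ub b0 Dx'].
apply: (mulIr Ub); apply: (mulIr Uv); rewrite divrK // mulrAC divrK //.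
rewrite -!rmorphM; congr (g _); apply: f_inj; rewrite !rmorphM -Dx.
by have -> : val x = f a / f b by []; rewrite mulrAC divfK // mulrC.
Qed.

Lemma locP (x : loc) :
  exists u v : O, [/\ g v \is a GRing.unit, f v != 0 & val x * f v = f u].
Proof.
by case/asboolP: (valP x) => -[a b] /= [Ub b0 Dx]; exists a, b; rewrite Dx divfK.
Qed.

Fact loc_red_zmod : zmod_morphism red.
Proof.
move=> x y; have [a [b [Ub b0 Dx]]] := locP x; have [c [d [Ud d0 Dy]]] := locP y.
rewrite (loc_redE Ub Dx) (loc_redE Ud Dy).
rewrite (@loc_redE _ (a * d - c * b) (b * d)) ?rmorphM ?unitrM ?Ub //.
  apply: (mulIr Ub); apply: (mulIr Ud).
  by rewrite -mulrA divrK ?unitrM ?Ub // rmorphB !rmorphM mulrBl mulrBl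
             divrK // (mulrAC (g c / g d)) divrK.
by rewrite !rmorphB !rmorphM -Dx -Dy; ring.
Qed.

Fact loc_red_monoid : monoid_morphism red.
Proof.
split=> [|x y].
  by rewrite (@loc_redE _ 1 1) ?rmorph1 ?unitr1 ?divr1 //= mulr1.
have [a [b [Ub b0 Dx]]] := locP x; have [c [d [Ud d0 Dy]]] := locP y.
rewrite (loc_redE Ub Dx) (loc_redE Ud Dy).
rewrite (@loc_redE _ (a * c) (b * d)) ?rmorphM ?unitrM ?Ub //.
  by rewrite mulrACA -invrM // [g d * _]mulrC.
by rewrite -Dx -Dy mulrACA.
Qed.
HB.instance Definition _ := GRing.isZmodMorphism.Build loc R red loc_red_zmod.
HB.instance Definition _ := GRing.isMonoidMorphism.Build loc R red loc_red_monoid.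

End Localization.

(** * The separable part of the characteristic polynomial *)

(** Let f = q (X - a)^m with q(a) nonzero. If the quotient did not vanish at a, then (X - a)^m would
    divide the gcd and so f', hence also m q (X - a)^(m-1); as m is invertible, a would be a root of
    q. *)
Lemma root_div_gcd_deriv (F : fieldType) (f : {poly F}) (a : F) :
  [pchar F] =i pred0 -> f != 0 -> root f a -> root (f %/ gcdp f f^`()) a.
Proof.
move=> F0 f0 fa; set g := gcdp f f^`().
have Df : f = f %/ g * g by rewrite divpK ?dvdp_gcdl.
have [m [q qa Dfm]] := multiplicity_XsubC f a; rewrite f0 /= in qa.
apply/negPn/negP=> ha.
have m_gt0 : (0 < m)%N.
  by case: m Dfm => // Dfm; rewrite Dfm mulr1 (negPf qa) in fa.
have : ('X - a%:P) ^+ m %| f^`().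
  apply: dvdp_trans (dvdp_gcdr f f^`()); rewrite -/g.
  have : ('X - a%:P) ^+ m %| f %/ g * g by rewrite -Df Dfm dvdp_mulIr.
  rewrite Gauss_dvdpr //.
  by rewrite coprimep_expl // coprimep_sym coprimep_XsubC.
rewrite {1}Dfm derivM dvdp_addr ?dvdp_mulIr // deriv_exp derivXsubC mul1r.
rewrite -{1}(prednK m_gt0) exprS -scaler_nat -scalerAr dvdpZr; last first.
  by move/pcharf0P: F0 => ->; rewrite -lt0n.
rewrite dvdp_mul2r ?expf_neq0 ?polyXsubC_eq0 // dvdp_XsubCl => qa1.
by rewrite qa1 in qa.
Qed.

Lemma pchar_fieldExt_rat (K : fieldExtType rat) : [pchar K] =i pred0.
Proof.
by move=> p; rewrite (fmorph_pchar (in_alg K)) Num.Theory.pchar_num.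
Qed.

(** The witness r is f / gcd(f, f') made monic. It keeps every root of f, so each of the n linear
    factors of f divides r. *)
Lemma separable_part (K : fieldExtType rat) (n : nat) (f : {poly rat})
    (alpha : 'I_n -> K) :
    map_poly (in_alg K) f = \prod_(i < n) ('X - (alpha i)%:P) ->
  exists r : {poly rat},
    [/\ map_poly (in_alg K) r = \prod_(a <- undup (codom alpha)) ('X - a%:P),
        separable_poly r, r %| f & f %| r ^+ n].
Proof.
move=> Df; have f0 : f != 0.
  by rewrite -(map_poly_eq0 (in_alg K)) Df monic_neq0 // monic_prod_XsubC.
have rootf i : root (map_poly (in_alg K) f) (alpha i).
  by rewrite Df (bigD1 i) //= rootE hornerM hornerXsubC subrr mul0r.
set g := f %/ gcdp f f^`().
have sep_g : separable_poly g := make_separable f0.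
have g0 := separable_poly_neq0 sep_g.
have gf : g %| f by rewrite -[X in _ %| X](divpK (dvdp_gcdl f f^`())) dvdp_mulr.
have rootg i : root (map_poly (in_alg K) g) (alpha i).
  rewrite map_divp gcdp_map -deriv_map; apply: root_div_gcd_deriv (rootf i).
    exact: pchar_fieldExt_rat.
  by rewrite map_poly_eq0.
pose r := (lead_coef g)^-1 *: g.
have c0 : (lead_coef g)^-1 != 0 by rewrite invr_eq0 lead_coef_eq0.
have Dr : map_poly (in_alg K) r = \prod_(a <- undup (codom alpha)) ('X - a%:P).
  (* As a divisor of a split polynomial, g is a subproduct up to a constant, and separability makes
     its factors distinct. *)
  have : map_poly (in_alg K) g %| \prod_(i <- codom alpha) ('X - i%:P).
    by rewrite big_image -Df dvdp_map.
  case/(@dvdp_prod_XsubC _ _ _ id) => m Dg.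
  have uniq_m : uniq (mask m (codom alpha)).
    by rewrite -separable_prod_XsubC -(eqp_separable Dg) separable_map.
  apply/eqP; rewrite -eqp_monic ?monic_prod_XsubC //; last first.
    by rewrite monic_map // monicE lead_coefZ mulVf // lead_coef_eq0.
  rewrite map_polyZ; apply: eqp_trans (eqp_scale _ _) _; first by rewrite fmorph_eq0.
  apply: (eqp_trans Dg); apply/eqpW/perm_big.
  apply: uniq_perm; rewrite ?undup_uniq // => x; rewrite mem_undup.
  apply/idP/idP=> [/mem_mask//|/codomP[i ->]].
  by rewrite -root_prod_XsubC -(eqp_root Dg).
exists r; split=> //.
- by rewrite (eqp_separable (eqp_scale _ c0)).
- by rewrite dvdpZl.
rewrite -(dvdp_map (in_alg K)) rmorphXn /= Df -[n in _ ^+ n]card_ord -prodr_const.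
apply: (big_ind2 (fun p q => p %| q)) => [||i _]; first exact: dvdpp.
  by move=> ? ? ? ?; apply: dvdp_mul.
by rewrite dvdp_XsubCl map_polyZ rootE hornerZ (eqP (rootg i)) mulr0.
Qed.

(** If A is diagonalizable, its minimal polynomial divides a product of distinct linear factors, so
    it is separable; dividing a power of r, it divides r. *)
Lemma diagonalizable_separable_part (K : fieldExtType rat) (n : nat)
    (A : 'M[rat]_n.+1) (r : {poly rat}) (s : seq K) :
    map_poly (in_alg K) r = \prod_(a <- s) ('X - a%:P) -> uniq s ->
    char_poly A %| r ^+ n.+1 ->
  diagonalizable (map_mx (in_alg K) A) <-> horner_mx A r = 0.
Proof.
move=> Dr uniq_s Ar.
have -> : horner_mx A r = 0 <->
    mxminpoly (map_mx (in_alg K) A) %| map_poly (in_alg K) r.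
  rewrite dvd_mxminpoly -map_horner_mx map_mx_eq0.
  by split=> /eqP.
rewrite diagonalizableP; split=> [[rs uniq_rs min_rs]|]; last first.
  by exists s; rewrite -?Dr.
apply: (@separable_dvdp_exp _ _ _ n.+1).
  by apply: dvdp_separable min_rs _; rewrite separable_prod_XsubC.
apply: dvdp_trans (mxminpoly_dvd_char _) _.
by rewrite -map_char_poly -rmorphXn dvdp_map.
Qed.

(** * Properties of all large primes, and denominators *)

Definition large_primes (P : nat -> Prop) : Prop :=
  exists N, forall p, prime p -> (N < p)%N -> P p.

Lemma large_primes_and (P Q : nat -> Prop) :
  large_primes P -> large_primes Q -> large_primes (fun p => P p /\ Q p).
Proof.
move=> [M HM] [N HN]; exists (maxn M N) => p p_pr; rewrite gtn_max => /andP[Mp Np].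
by split; [apply: HM | apply: HN].
Qed.

Lemma large_primes_all (T : eqType) (s : seq T) (P : T -> nat -> Prop) :
  (forall x, x \in s -> large_primes (P x)) ->
  large_primes (fun p => forall x, x \in s -> P x p).
Proof.
elim: s => [|x s IHs] Ps; first by exists 0%N.
have [||N HN] := @large_primes_and (P x) (fun p => forall y, y \in s -> P y p).
- exact/Ps/mem_head.
- by apply: IHs => y sy; apply/Ps/mem_behead.
exists N => p p_pr Np y; have [Px Psp] := HN p p_pr Np.
by rewrite inE => /predU1P[->|/Psp].
Qed.

Lemma large_primes_forall (T : finType) (P : T -> nat -> Prop) :
  (forall x, large_primes (P x)) -> large_primes (fun p => forall x, P x p).
Proof.
move=> HP; have [N HN] := large_primes_all (fun x (_ : x \in enum T) => HP x).
by exists N => p p_pr Np x; apply: HN; rewrite ?mem_enum.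
Qed.

Lemma large_primes_ndvd (m : nat) :
  (0 < m)%N -> large_primes (fun p => ~~ (p %| m)%N).
Proof. by exists m => p _ mp; rewrite gtnNdvd. Qed.

Definition p_integral (p : nat) (x : rat) : bool := ~~ (p%:Z %| denq x)%Z.

Lemma large_primes_p_integral (x : rat) : large_primes (fun p => p_integral p x).
Proof.
have [|N HN] := @large_primes_ndvd `|denq x|%N; first by rewrite absz_gt0 denq_neq0.
by exists N => p p_pr Np; apply: HN.
Qed.

Lemma large_primes_p_integral_poly (q : {poly rat}) :
  large_primes (fun p => forall i, p_integral p q`_i).
Proof.
have [N HN] := @large_primes_forall 'I_(size q) (fun i p => p_integral p q`_i)
  (fun i => large_primes_p_integral _).
exists N => p p_pr Np i; have [lt_iq|le_qi] := ltnP i (size q).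
  exact: (HN p p_pr Np (Ordinal lt_iq)).
by rewrite nth_default // /p_integral (_ : denq 0 = 1) // dvdz1 gtn_eqF ?prime_gt1.
Qed.

Section DenominatorsK.
Variable K : fieldExtType rat.

Lemma natr_fieldExt_neq0 (d : nat) : (0 < d)%N -> d%:R != 0 :> K.
Proof. by move: (@pchar_fieldExt_rat K) => /pcharf0P ->; rewrite lt0n. Qed.

(** Clearing denominators in the minimal polynomial gives an integer polynomial vanishing at x;
    multiplying x by its leading coefficient l makes it integral, and d is the absolute value of
    l. *)
Lemma denominator_integral (x : K) :
  exists2 d : nat, (0 < d)%N & d%:R * x \in @ringOfIntegers_pred K.
Proof.
have /polyOver1P[q Dq] := minPolyOver 1 x.
have [qz [a a0 Dqz]] := rat_poly_scale q.
have q0 : q != 0.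
  by rewrite -(map_poly_eq0 (in_alg K)) -Dq monic_neq0 // monic_minPoly.
have qz0 : qz != 0 by apply: contraNneq q0 => z0; rewrite Dqz z0 rmorph0 scaler0.
pose l := lead_coef qz; have l0 : l != 0 by rewrite lead_coef_eq0.
exists `|l|%N; first by rewrite absz_gt0.
have root_qz : root (map_poly (intr : int -> K) qz) x.
  have := root_minPoly 1 x; rewrite Dq Dqz map_polyZ rootE hornerZ mulf_eq0.
  rewrite fmorph_eq0 invr_eq0 intr_eq0 (negPf a0) /= -map_poly_comp.
  rewrite (eq_map_poly (_ : _ =1 (intr : int -> K))) // => y /=.
  exact: (rmorph_int (in_alg K)).
suff Ilx : l%:~R * x \in @ringOfIntegers_pred K.
  rewrite -[_%:R]/((`|l|%N : int)%:~R) abszE.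
  have [l_ge0|l_lt0] := lerP 0 l; first by rewrite ger0_norm.
  by rewrite ltr0_norm // rmorphN mulNr rpredN.
have injK : injective (intr : int -> K).
  by move=> y z; rewrite -!(rmorph_int (in_alg K)) => /fmorph_inj /intr_inj.
have szK : size (map_poly (intr : int -> K) qz) = size qz.
  by rewrite size_map_poly_id0 // -(rmorph0 (intr : int -> K)) (inj_eq injK).
have [m Dm] : exists m, size qz = m.+2.
  have : (1 < size qz)%N.
    by rewrite -szK (root_size_gt1 _ root_qz) // -size_poly_eq0 szK size_poly_eq0.
  by case: (size qz) => [|[|m]] // _; exists m.
(* h(l X) = l^m qz(X), where m + 1 is the degree of qz. *)
pose h := \poly_(i < m.+2) (if i == m.+1 then 1 else qz`_i * l ^+ (m - i)).
have h_monic : h \is monic by rewrite monicE lead_coef_poly //= eqxx ?oner_neq0.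
apply/asboolP; exists h => //; apply/rootP.
rewrite (_ : map_poly _ h = \poly_(i < m.+2)
   (if i == m.+1 then 1 else (qz`_i * l ^+ (m - i))%:~R)); last first.
  apply/polyP=> i; rewrite coef_map !coef_poly /=.
  by case: ifP => // _; case: ifP => // _; rewrite rmorph1.
rewrite horner_poly big_ord_recr /= eqxx mul1r.
have /(congr1 (fun y => l%:~R ^+ m * y)) := rootP root_qz.
rewrite mulr0 horner_coef szK Dm big_ord_recr /= => Dh0; rewrite -[RHS]Dh0.
rewrite mulrDr mulr_sumr coef_map; congr (_ + _).
  apply: eq_bigr => i _; rewrite ltn_eqF // coef_map /= rmorphM rmorphXn exprMn /=.
  have <- : l%:~R ^+ (m - i) * l%:~R ^+ i = l%:~R ^+ m :> K.
    by rewrite -exprD subnK // -ltnS.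
  ring.
rewrite /l lead_coefE Dm /= exprMn exprSr; ring.
Qed.
End DenominatorsK.

(** * Reduction modulo p of Q and of K *)

Section FpMorphism.
Variables (R : nzRingType) (p : nat) (pR : p \in [pchar R]).

(** The canonical map from the prime field. The characteristic is an argument so that the morphism
    structure can be attached to this constant. *)
Definition Fp_inj of p \in [pchar R] := fun x : 'F_p => (x : nat)%:R : R.

Let natr_modp m : (m %% p)%:R = m%:R :> R.
Proof. by rewrite {2}(divn_eq m p) natrD natrM (pcharf0 pR) mulr0 add0r. Qed.

Lemma Fp_inj_nat m : Fp_inj pR m%:R = m%:R.
Proof. by rewrite /Fp_inj val_Fp_nat ?natr_modp // (pcharf_prime pR). Qed.

Let Fp_natr (x : 'F_p) : x = (x : nat)%:R.
Proof. exact/esym/natr_Zp. Qed.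

Fact Fp_inj_zmod : zmod_morphism (Fp_inj pR).
Proof.
move=> x y; apply: (@addIr _ (Fp_inj pR y)); rewrite subrK.
rewrite -[in RHS](subrK y x); move: (x - y) => z.
have -> : z + y = ((z : nat) + (y : nat))%N%:R by rewrite natrD -!Fp_natr.
by rewrite Fp_inj_nat natrD.
Qed.

Fact Fp_inj_monoid : monoid_morphism (Fp_inj pR).
Proof.
split=> [|x y]; first exact: (Fp_inj_nat 1).
have -> : x * y = ((x : nat) * (y : nat))%N%:R by rewrite natrM -!Fp_natr.
by rewrite Fp_inj_nat natrM.
Qed.
HB.instance Definition _ :=
  GRing.isZmodMorphism.Build 'F_p R (Fp_inj pR) Fp_inj_zmod.
HB.instance Definition _ :=
  GRing.isMonoidMorphism.Build 'F_p R (Fp_inj pR) Fp_inj_monoid.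
End FpMorphism.

Section ReductionQ.
Variables (p : nat) (p_pr : prime p).

Definition locQ :=
  loc (intr : {rmorphism int -> rat}) (intr : {rmorphism int -> 'F_p}).
HB.instance Definition _ := GRing.ComNzRing.on locQ.

Fact intr_rat_inj : injective (intr : {rmorphism int -> rat}).
Proof. exact: intr_inj. Qed.

Definition redQ : locQ -> 'F_p := loc_red (g := intr) intr_rat_inj.
HB.instance Definition _ := GRing.RMorphism.on redQ.

Lemma Fp_int_unit (m : int) : ((m%:~R : 'F_p) \is a GRing.unit) = ~~ (p%:Z %| m)%Z.
Proof. by rewrite unitfE (dvdz_pcharf (pchar_Fp p_pr)). Qed.

Lemma p_integral_loc (x : rat) : p_integral p x ->
  x \in loc_pred (intr : {rmorphism int -> rat}) (intr : {rmorphism int -> 'F_p}).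
Proof.
move=> px; apply/asboolP; exists (numq x, denq x).
split; rewrite /= ?divq_num_den //.
  by rewrite Fp_int_unit.
by rewrite intr_eq0 denq_neq0.
Qed.

(** No ring morphism goes from Q to ['F_p]; this exchanges [ratr], used in [red_mx], for a genuine
    morphism on the rationals integral at p. *)
Lemma redQ_ratr (x : locQ) : p_integral p (val x) -> redQ x = ratr (val x).
Proof.
move=> px; rewrite /redQ (@loc_redE _ _ _ _ _ _ _ (numq (val x)) (denq (val x))) //.
  by rewrite Fp_int_unit.
by rewrite -{1}[val x]divq_num_den divfK // intr_eq0 denq_neq0.
Qed.

End ReductionQ.

Section Lift.
Variables (O : comNzRingType) (k : fieldType) (R : comUnitRingType).
Variables (f : {rmorphism O -> k}) (g : {rmorphism O -> R}).
Local Notation T := (loc f g).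

Lemma lift_poly_loc (q : {poly k}) : (forall i, q`_i \in loc_pred f g) ->
  exists q0 : {poly T}, map_poly val q0 = q.
Proof.
move=> Lq; exists (map_poly (insubd (0 : T)) q).
apply/polyP=> i; rewrite coef_map coef_map_id0; last first.
  by apply: val_inj; rewrite /= insubdK ?rmorph0 //; apply: rpred0.
by rewrite /= insubdK //; apply: Lq.
Qed.

Lemma lift_mx_loc (m n : nat) (A : 'M[k]_(m, n)) :
  (forall i j, A i j \in loc_pred f g) ->
  exists A0 : 'M[T]_(m, n), map_mx val A0 = A.
Proof.
move=> LA; exists (map_mx (insubd (0 : T)) A).
by apply/matrixP=> i j; rewrite !mxE insubdK //; apply: LA.
Qed.

End Lift.

Section ReductionK.
Variables (K : fieldExtType rat) (p : nat) (p_pr : prime p).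
Local Notation OK := (ringOfIntegers K).
Local Notation OKval := (val : OK -> K).

Definition locK :=
  loc (OKval : {rmorphism OK -> K}) (pi_OK p_pr : {rmorphism OK -> OKmod K p_pr}).
HB.instance Definition _ := GRing.ComNzRing.on locK.

Fact OKval_inj : injective (OKval : {rmorphism OK -> K}).
Proof. exact: val_inj. Qed.

Definition redK : locK -> OKmod K p_pr := loc_red (g := pi_OK p_pr) OKval_inj.
HB.instance Definition _ := GRing.RMorphism.on redK.

Lemma pi_OK_eq0 (x : OK) : pi_OK p_pr x = 0 <-> exists y : OK, x = p%:R * y.
Proof.
rewrite -(rmorph0 (pi_OK p_pr)); apply: (iff_trans (rwP eqP)).
by rewrite -Quotient.idealrBE subr0; split=> /asboolP.
Qed.

Lemma pchar_OKmod : p \in [pchar OKmod K p_pr].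
Proof.
rewrite inE p_pr /= -(rmorph_nat (pi_OK p_pr)); apply/eqP/pi_OK_eq0.
by exists 1; rewrite mulr1.
Qed.

Lemma pi_OK_unitP (b : OK) :
  reflect (coprime_OK p b) (pi_OK p_pr b \is a GRing.unit).
Proof.
apply: (iffP idP) => [/unitrPr[v uv1]|]; last exact: pi_OK_unit.
have [w Dw] : exists w, v = pi_OK p_pr w.
  by exists (generic_quotient.repr v); rewrite /pi_OK generic_quotient.reprK.
have : pi_OK p_pr (1 - w * b) = 0.
  rewrite rmorphB rmorphM rmorph1 /= -Dw mulrC uv1; apply: subrr.
by case/pi_OK_eq0=> y Dy; exists w, y; rewrite -Dy addrC subrK.
Qed.

Local Notation iota := (Fp_inj pchar_OKmod).

(** Both sides can be computed from one integer fraction a / b whose denominator is prime to p. *)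
Lemma redK_redQ (x : locQ p) (y : locK) :
  val y = in_alg K (val x) -> redK y = iota (redQ x).
Proof.
move=> Dy; have [a [b [Ub b0 Dx]]] := locP x.
rewrite /redQ (loc_redE _ Ub Dx).
have pi_int (m : int) : pi_OK p_pr m%:~R = iota m%:~R by rewrite !rmorph_int.
rewrite /redK (@loc_redE _ _ _ _ _ _ _ a%:~R b%:~R).
- by rewrite (rmorph_div iota _ Ub) /= !pi_int.
- by rewrite /= pi_int rmorph_unit.
by rewrite Dy !rmorph_int -(rmorph_int (in_alg K)) -rmorphM Dx rmorph_int.
Qed.

(** Integrality of the inverse makes [redK x] a unit, so in a fraction a / b for x the numerator is
    also a unit modulo p, and (a, b) is admissible for [red_elt]. *)
Lemma red_eltE_loc (x : locK) : val x != 0 ->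
    (val x)^-1 \in loc_pred (OKval : {rmorphism OK -> K}) (pi_OK p_pr) ->
  coprime_elt p (val x) /\ red_elt p_pr (val x) = redK x.
Proof.
move=> x0 Lx; have [a [b [Ub b0 Dx]]] := locP x.
have Ex := loc_redE OKval_inj Ub Dx.
have Ua : pi_OK p_pr a \is a GRing.unit.
  have -> : pi_OK p_pr a = redK x * pi_OK p_pr b by rewrite /redK Ex divrK.
  rewrite unitrM Ub andbT.
  by apply: (rmorph_unit_of_inv (y := Loc Lx) _ _ x0); first exact: val_inj.
have fx : coprime_frac p (val x) (a, b).
  by split; [exact/pi_OK_unitP | exact/pi_OK_unitP | rewrite -Dx /= mulfK].
by split; [exists (a, b) | rewrite (red_eltE p_pr fx)].
Qed.

Lemma locK_denominator (x : K) (d : nat) : ~~ (p %| d)%N ->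
  d%:R * x \in @ringOfIntegers_pred K ->
  x \in loc_pred (OKval : {rmorphism OK -> K}) (pi_OK p_pr).
Proof.
move=> pd Ox; have d_gt0 : (0 < d)%N by case: d pd {Ox}; rewrite ?dvdn0.
apply/asboolP; exists (RingOfIntegers Ox, d%:R).
have Dd : OKval d%:R = d%:R by rewrite rmorph_nat.
have d0 := natr_fieldExt_neq0 K d_gt0.
split.
- by rewrite /= rmorph_nat -(Fp_inj_nat pchar_OKmod) rmorph_unit // unitfE
             -(dvdn_pcharf (pchar_Fp p_pr)).
- by rewrite [f in f != 0]Dd.
by rewrite [X in _ / X]Dd mulrC mulKf.
Qed.

End ReductionK.

Lemma large_primes_locK (K : fieldExtType rat) (x : K) :
  exists N, forall p (p_pr : prime p), (N < p)%N ->
    x \in loc_pred (val : {rmorphism ringOfIntegers K -> K}) (pi_OK p_pr).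
Proof.
have [d d_gt0 Ox] := denominator_integral x.
have [N HN] := large_primes_ndvd d_gt0.
by exists N => p p_pr Np; apply: locK_denominator Ox; apply: HN.
Qed.

(** * Orders and the exponents they divide *)

Lemma mul_order_dvd (R : nzRingType) (u : R) (k : nat) :
  (mul_order u %| k)%N = (u ^+ k == 1).
Proof.
rewrite /mul_order; case: pselect => [h|nh]; last first.
  (* The default order 0 divides only k = 0, the one exponent giving 1 in this case. *)
  rewrite dvd0n; apply/idP/idP=> [/eqP->|uk1]; first by rewrite expr0.
  by case: k uk1 => // k uk1; case: nh; exists k.+1.
case: ex_minnP => m /andP[m_gt0 /eqP um1] min_m.
rewrite [in RHS](divn_eq k m) mulnC exprD exprM um1 expr1n mul1r.
apply/idP/idP=> [/eqP->|ukm1]; first by rewrite expr0.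
have := ltn_pmod k m_gt0; rewrite /dvdn ltnNge; apply: contraNT => km0.
by rewrite min_m // lt0n km0.
Qed.

Lemma ord_mx_dvd (n p : nat) (A : 'M[rat]_n.+1) (k : nat) :
  red_mx p A \in unitmx -> (ord_mx p A %| k)%N = (red_mx p A ^+ k == 1).
Proof.
move=> UA; rewrite /ord_mx order_dvdn -(inj_eq val_inj).
have -> m (g : {'GL_m.+1['F_p]}) : val (g ^+ k)%g = (val g) ^+ k.
  by elim: k => // k IHk; rewrite expgS /= exprS -IHk.
by rewrite insubdK.
Qed.

Lemma uniq_roots_map (T : eqType) (R : comUnitRingType) (h : T -> R) (s : seq T) :
  uniq s -> {in s &, forall x y, x != y -> h x - h y \is a GRing.unit} ->
  uniq_roots (map h s).
Proof.
elim: s => //= x s IHs /andP[s'x uniq_s] Uh; apply/andP; split.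
  apply/allP=> _ /mapP[y sy ->]; rewrite /diff_roots mulrC eqxx /=.
  by apply: Uh; rewrite ?inE ?eqxx ?sy ?orbT //; apply: contraNneq s'x => <-.
by apply: IHs => // y z sy sz; apply: Uh; rewrite inE ?sy ?sz orbT.
Qed.

(** * Transfer of polynomial identities to the residue field *)

Section Reduction.
Variables (T : comNzRingType) (k F : fieldType).
Variables (inc : {rmorphism T -> k}) (red : {rmorphism T -> F}).
Hypothesis inc_inj : injective inc.

Let inc_poly_inj : injective (map_poly inc).
Proof. by apply: map_inj_poly inc_inj _; apply: rmorph0. Qed.

Variables (n : nat) (A : 'M[T]_n.+1) (r s w u v : {poly T}).
Hypotheses
  (bezout : map_poly inc u * map_poly inc r
            + map_poly inc v * (map_poly inc r)^`() = 1)
  (char_r : char_poly (map_mx inc A) = map_poly inc s * map_poly inc r)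
  (r_char : map_poly inc r ^+ n.+1 = map_poly inc w * char_poly (map_mx inc A)).

(** Coprimality and divisibility are given by identities with explicit cofactors over T: injectivity
    of [inc] brings them back to T, and [red] carries them to F. *)
Lemma reduction_separable : separable_poly (map_poly red r).
Proof.
have bez : u * r + v * r^`() = 1.
  by apply: inc_poly_inj; rewrite rmorphD !rmorphM rmorph1 /= -deriv_map.
rewrite unlock; apply/Bezout_eq1_coprimepP.
exists (map_poly red u, map_poly red v) => /=.
by rewrite deriv_map -!rmorphM -rmorphD bez rmorph1.
Qed.

Lemma reduction_dvd_char : map_poly red r %| char_poly (map_mx red A).
Proof.
have chA : char_poly A = s * r.
  by apply: inc_poly_inj; rewrite rmorphM /= map_char_poly.
by rewrite -map_char_poly chA rmorphM dvdp_mulIr.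
Qed.

Lemma reduction_char_dvd : char_poly (map_mx red A) %| map_poly red r ^+ n.+1.
Proof.
have rA : r ^+ n.+1 = w * char_poly A.
  by apply: inc_poly_inj; rewrite rmorphM rmorphXn /= map_char_poly.
by rewrite -map_char_poly -rmorphXn rA rmorphM dvdp_mulIr.
Qed.

Lemma reduction_unitmx (d : T) : map_mx inc A \in unitmx ->
  inc d = (\det (map_mx inc A))^-1 -> map_mx red A \in unitmx.
Proof.
rewrite !unitmxE !det_map_mx unitfE; exact: rmorph_unit_of_inv.
Qed.

(** A nonzero entry has its inverse in T, so it reduces to a unit and cannot vanish. At a zero entry
    the convention 0^-1 = 0 makes e = 0 a witness. *)
Lemma reduction_horner_mx :
    (forall i j, exists e,
       inc e = (horner_mx (map_mx inc A) (map_poly inc r) i j)^-1) ->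
  (horner_mx (map_mx red A) (map_poly red r) == 0) =
  (horner_mx (map_mx inc A) (map_poly inc r) == 0).
Proof.
rewrite -!map_horner_mx => inv_e; apply/eqP/eqP=> /matrixP h0; apply/matrixP=> i j.
  have := h0 i j; have [e] := inv_e i j; rewrite !mxE => De redh0.
  apply/eqP; apply: contraT => h_neq0.
  by have := rmorph_unit_of_inv red inc_inj h_neq0 De; rewrite redh0 unitr0.
have := h0 i j; rewrite !mxE -[RHS](rmorph0 inc) => /inc_inj ->.
exact: rmorph0.
Qed.

End Reduction.

(** The product is formed once over S; [compat] then applies to its coefficients against those of
    r. *)
Lemma reduction_prod_XsubC (Q F K : fieldType) (T S : comNzRingType) (R : nzRingType)
    (inQ : {rmorphism T -> Q}) (redF : {rmorphism T -> F})
    (inK : {rmorphism S -> K}) (redR : {rmorphism S -> R})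
    (iota : {rmorphism F -> R}) (j : {rmorphism Q -> K})
    (r : {poly T}) (c : seq S) :
    (forall x y, inK y = j (inQ x) -> redR y = iota (redF x)) ->
    map_poly j (map_poly inQ r) = \prod_(a <- map inK c) ('X - a%:P) ->
  map_poly iota (map_poly redF r) = \prod_(z <- map redR c) ('X - z%:P).
Proof.
have map_prod (B : nzRingType) (h : {rmorphism S -> B}) :
    \prod_(z <- map h c) ('X - z%:P) = map_poly h (\prod_(z <- c) ('X - z%:P)).
  rewrite rmorph_prod big_map; apply: eq_bigr => z _.
  by rewrite rmorphB /= map_polyX map_polyC.
move=> compat; rewrite !map_prod => Dr; apply/polyP=> i; rewrite !coef_map.
by apply/esym/compat; have /polyP/(_ i) := Dr; rewrite !coef_map.
Qed.

Lemma dvdn_lcm_ord_elt (K : fieldExtType rat) (p : nat) (p_pr : prime p) (n : nat)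
    (c : 'I_n -> locK K p_pr) (k : nat) :
    (forall i, red_elt p_pr (val (c i)) = redK (c i)) ->
  (\big[lcmn/1%N]_(i < n) ord_elt p_pr (val (c i)) %| k)%N =
  all (fun z => z ^+ k == 1) (map (@redK K p p_pr) (undup (codom c))).
Proof.
move=> Dc; apply/dvdn_biglcmP/allP=> [H _ /mapP[x + ->]|H i _].
  by rewrite mem_undup => /codomP[i ->]; have := H i isT; rewrite mul_order_dvd Dc.
by rewrite mul_order_dvd Dc; apply/H/map_f; rewrite mem_undup codom_f.
Qed.

(** * Choice of the bound on p, and conclusion over the residue rings *)

Theorem theorem4p2 (n : nat) (A : 'M[rat]_n.+1) (K : fieldExtType rat)
    (alpha : 'I_n.+1 -> K) :
  A \in unitmx ->
  splittingFieldFor 1%VS (map_poly (in_alg K) (char_poly A)) fullv ->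
  map_poly (in_alg K) (char_poly A) = \prod_(i < n.+1) ('X - (alpha i)%:P) ->
  exists N : nat, forall (p : nat) (p_pr : prime p), (N < p)%N ->
    [/\ reducible_mx p A /\ red_mx p A \in unitmx,
        forall i, coprime_elt p (alpha i),
        diagonalizable (map_mx (in_alg K) A) ->
          ord_mx p A = (\big[lcmn/1]_(i < n.+1) ord_elt p_pr (alpha i))%N
      & ~ diagonalizable (map_mx (in_alg K) A) ->
          ord_mx p A =
            (p * \big[lcmn/1]_(i < n.+1) ord_elt p_pr (alpha i))%N].
Proof.
move=> UA _ Df; have [r [Dr sep_r r_char char_r]] := separable_part Df.
(* Cofactors and Bezout coefficients are named because p must avoid their denominators too. *)
have [s Ds] := dvdpP _ _ r_char; have [w Dw] := dvdpP _ _ char_r.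
have [[u v] /= bez] : exists u : {poly rat} * {poly rat}, u.1 * r + u.2 * r^`() = 1.
  by move: sep_r; rewrite unlock => /Bezout_eq1_coprimepP.
have diagP := diagonalizable_separable_part Dr (undup_uniq _) char_r.
(* A zero root would annihilate the constant coefficient, which is det A up to sign. *)
have alpha0 i : alpha i != 0.
  apply: contraTneq UA => a0; rewrite unitmxE unitfE negbK.
  have : root (map_poly (in_alg K) (char_poly A)) 0.
    by rewrite Df (bigD1 i) //= a0 rootE hornerM hornerXsubC subrr mul0r.
  rewrite rootE horner_coef0 coef_map fmorph_eq0 char_poly_det.
  by rewrite mulf_eq0 signr_eq0.
pose int_K x p := forall p_pr : prime p,
  x \in loc_pred (val : {rmorphism ringOfIntegers K -> K}) (pi_OK p_pr).
have large_int_K x : large_primes (int_K x).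
  by have [N HN] := large_primes_locK x; exists N => p _ Np p_pr; apply: HN.
(* Inverses of the entries of r(A) are included so that r(A) can vanish modulo p only if it is 0. *)
have [N1 H1] := @large_primes_forall _ (fun ij p =>
  p_integral p (A ij.1 ij.2) /\ p_integral p (horner_mx A r ij.1 ij.2)^-1)
  (fun ij : 'I_n.+1 * 'I_n.+1 => large_primes_and
    (large_primes_p_integral _) (large_primes_p_integral _)).
have [N2 H2] := @large_primes_all _ [:: r; s; w; u; v]
  (fun q p => forall i, p_integral p q`_i)
  (fun q _ => large_primes_p_integral_poly q).
have [N3 H3] := large_primes_p_integral (\det A)^-1.
(* The inverses make the roots units modulo p and make distinct roots differ by units. *)
have [N4 H4] := @large_primes_forall _ (fun ij p =>
  int_K (alpha ij.1) p /\ (int_K (alpha ij.1)^-1 p /\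
                           int_K (alpha ij.1 - alpha ij.2)^-1 p))
  (fun ij : 'I_n.+1 * 'I_n.+1 => large_primes_and (large_int_K _)
     (large_primes_and (large_int_K _) (large_int_K _))).
(* The summand n ensures n + 1 <= p, so that r^(n+1) divides r^p modulo p. *)
exists (n + N1 + N2 + N3 + N4)%N => p p_pr Np.
have {}H1 := H1 p p_pr ltac:(lia); have {}H2 := H2 p p_pr ltac:(lia).
have {}H3 := H3 p p_pr ltac:(lia); have {}H4 := H4 p p_pr ltac:(lia).
have n_lt_p : (n < p)%N by lia.
have lift q : q \in [:: r; s; w; u; v] ->
  exists q0 : {poly locQ p}, map_poly val q0 = q.
  by move=> /H2 pq; apply: lift_poly_loc => i; apply: p_integral_loc (pq i).
have [r0 Dr0] := lift r ltac:(by rewrite !inE eqxx ?orbT).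
have [s0 Ds0] := lift s ltac:(by rewrite !inE eqxx ?orbT).
have [w0 Dw0] := lift w ltac:(by rewrite !inE eqxx ?orbT).
have [u0 Du0] := lift u ltac:(by rewrite !inE eqxx ?orbT).
have [v0 Dv0] := lift v ltac:(by rewrite !inE eqxx ?orbT).
have [A0 DA] : exists A0 : 'M[locQ p]_n.+1, map_mx val A0 = A.
  by apply: lift_mx_loc => i j; apply: p_integral_loc (H1 (i, j)).1.
have DB : red_mx p A = map_mx (@redQ p) A0.
  apply/matrixP=> i j; have := (H1 (i, j)).1; rewrite -DA !mxE => pA.
  exact/esym/redQ_ratr.
pose rp := map_poly (@redQ p) r0; pose inc : {rmorphism locQ p -> rat} := val.
have inc_inj : injective inc := val_inj.
have bez0 :
    map_poly inc u0 * map_poly inc r0 + map_poly inc v0 * (map_poly inc r0)^`() = 1.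
  by rewrite Du0 Dr0 Dv0.
have chA0 : char_poly (map_mx inc A0) = map_poly inc s0 * map_poly inc r0.
  by rewrite DA Ds0 Dr0.
have rA0 : map_poly inc r0 ^+ n.+1 = map_poly inc w0 * char_poly (map_mx inc A0).
  by rewrite DA Dw0 Dr0.
have sep_rp : separable_poly rp := reduction_separable _ inc_inj bez0.
have rp_char : rp %| char_poly (red_mx p A).
  by rewrite DB; apply: reduction_dvd_char chA0.
have char_rp : char_poly (red_mx p A) %| rp ^+ n.+1.
  by rewrite DB; apply: reduction_char_dvd rA0.
have UB : red_mx p A \in unitmx.
  rewrite DB.
  apply: (@reduction_unitmx _ _ _ inc _ inc_inj _ _
    (Loc (p_integral_loc p_pr H3))).
    by rewrite DA.
  by rewrite DA.
have rpB : (horner_mx (red_mx p A) rp == 0) = (horner_mx A r == 0).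
  rewrite DB -DA -Dr0; apply: (reduction_horner_mx _ inc_inj) => i j.
  have px := (H1 (i, j)).2; rewrite DA Dr0.
  by exists (Loc (p_integral_loc p_pr px)).
pose c i := Loc ((H4 (i, i)).1 p_pr) : locK K p_pr.
have Dc i : coprime_elt p (alpha i) /\ red_elt p_pr (alpha i) = redK (c i).
  exact: (red_eltE_loc (x := c i) (alpha0 i) ((H4 (i, i)).2.1 p_pr)).
have Dcod : codom alpha = map val (codom c).
  by rewrite !codomE -[RHS]map_comp.
have uniq_c : uniq_roots (map (@redK K p p_pr) (undup (codom c))).
  apply: uniq_roots_map (undup_uniq _) _ => x y.
  rewrite !mem_undup => /codomP[i ->] /codomP[j ->] cij.
  rewrite -rmorphB.
  apply: (@rmorph_unit_of_inv _ _ _ (val : {rmorphism locK K p_pr -> K}) _ _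
    (Loc ((H4 (i, j)).2.2 p_pr))); first exact: val_inj.
    by rewrite rmorphB subr_eq0 (inj_eq val_inj).
  by rewrite rmorphB.
have Drp : map_poly (Fp_inj (pchar_OKmod K p_pr)) rp =
    \prod_(z <- map (@redK K p p_pr) (undup (codom c))) ('X - z%:P).
  apply: (@reduction_prod_XsubC _ _ _ _ _ _ inc _
    (val : {rmorphism locK K p_pr -> K}) _ _ (in_alg K)); first exact: redK_redQ.
  by rewrite Dr0 Dr Dcod undup_map_inj //; apply: val_inj.
set L := (\big[lcmn/1]_(i < n.+1) ord_elt p_pr (alpha i))%N.
have LP k : (L %| k)%N = (rp %| 'X^k - 1).
  rewrite (dvdp_map_roots _ Drp uniq_c).
  rewrite (@dvdn_lcm_ord_elt _ _ _ _ c _ (fun i => (Dc i).2)).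
  apply: eq_all => z.
  by rewrite rmorphB /= map_polyXn rmorph1 rootE !hornerE subr_eq0.
have dP k : (ord_mx p A %| k)%N = (red_mx p A ^+ k == 1) := ord_mx_dvd k UB.
have d_gt0 : (0 < ord_mx p A)%N by apply: order_gt0.
split=> [|i|/diagP h0|ndiag]; first by split=> // i j; have [] := H1 (i, j).
- exact: (Dc i).1.
- by apply: (order_semisimple sep_rp rp_char dP LP); apply/eqP; rewrite rpB h0.
apply: (order_not_semisimple (pchar_Fp p_pr) n_lt_p d_gt0 sep_rp rp_char char_rp
  dP LP).
by rewrite rpB; apply/eqP => /diagP.
Qed.
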